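(* Let $\{h_{11}^n\}_{n=0}^\infty$ be a sequence of positive real numbers, and let $\mu$ be the even measure on the unit circle $\mathbb{T}$ such that $|\varphi_n(1)|^2=h_{11}^n$ for all $n\geqslant0$, where $\{\varphi_n\}$ is the family of polynomials orthonormal in $L^2_{\frac{\mu}{2\pi}}(\mathbb{T})$. Let $c_k$ be the moments of $\mu$, let $\tilde c_k=c_k/c_0$ be the normalized moments, where $c_0=1/h_{11}^0$, and let $\tilde h^{k}=h_{11}^{k}/h_{11}^0$. Let $J_{n-1}=(\tilde c_{j-i})_{i,j=0}^{n-1}$ be the Toeplitz matrix of the normalized moments with rows and columns indexed by $0,\dots,n-1$, let $u_n=(\tilde c_1,\tilde c_2,\dots,\tilde c_n)^T$, $v_n=(\tilde c_n,\tilde c_{n-1},\dots,\tilde c_1)^T$, let $\mathbb{1}=(1,1,\dots,1)$ be the row vector with $n$ entries, and set $$\Delta_n=1-u_n^TJ_{n-1}^{-1}u_n,\qquad D_n=u_n^TJ_{n-1}^{-1}v_n.$$ Then for $n>1$, the moment $c_{n+1}$ can be solved for from the preceding moments by the formula $$c_{n+1}=\frac{1}{h_{11}^0}\cdot\frac{\left(1+D_n/\Delta_n\right)\left(1-\mathbb{1}J_{n-1}^{-1}u_n\right)^2-(\Delta_n-D_n)\,\tilde h^{n+1}}{\tilde h^{n+1}\,\Delta_n+\left(1-\mathbb{1}J_{n-1}^{-1}u_n\right)^2/\Delta_n}.$$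
   Context: The unit circle $\mathbb{T}$ is identified with $[-\pi,\pi)$ via $x\mapsto e^{ix}$, and a measure on $\mathbb{T}$ is even if it is invariant under $x\mapsto-x$. For every sequence $\{h_{11}^n\}$ of positive numbers there is a unique even measure $\mu$ on $\mathbb{T}$ with $|\varphi_n(1)|^2=h_{11}^n$ for all $n$; it is finite, positive and has infinite support. The moments are $c_k=\int_{\mathbb{T}}e^{-ikx}\frac{d\mu(x)}{2\pi}$, $k\in\mathbb{Z}$; for even $\mu$ they are real with $c_{-k}=c_k$. The inner product in $L^2_{\frac{\mu}{2\pi}}(\mathbb{T})$ is $\langle p,q\rangle=\int_{\mathbb{T}}p\,\overline q\,\frac{d\mu}{2\pi}$, and $\varphi_n$ is the orthonormal polynomial of degree $n$ obtained by Gram-Schmidt from $1,z,z^2,\dots$. Since $\mu$ has infinite support, all matrices $J_{n-1}$ are invertible.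
   Formalization: The printed denominator is false (for c_k=2^{-|k|}, n=2 it gives c_3=1/7 instead of 1/8); the theorem proved has the factor Δ_n next to h̃^{n+1} removed, so the denominator is h̃^{n+1}+(1-𝟙J_{n-1}^{-1}u_n)²/Δ_n. *)

(* Defs.v *)
From HB Require Import structures.
From mathcomp Require Import all_boot all_order all_algebra.
From mathcomp Require Import complex.
From mathcomp Require Import all_classical all_reals all_analysis.

Set Implicit Arguments.
Unset Strict Implicit.
Unset Printing Implicit Defensive.
Import Order.TTheory GRing.Theory Num.Theory.
Import numFieldNormedType.Exports.
Local Open Scope classical_set_scope.
Local Open Scope ring_scope.
Local Open Scope complex_scope.

Definition expi (R : realType) (x : R) : R[i] := cos x +i* sin x.

(* The unit circle is identified with [-pi, pi) through x |-> e^{ix}; a measure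
   on it is a measure on R that is concentrated on [-pi, pi).                 *)
Definition circle (R : realType) : set (measurableTypeR R) :=
  `[- (pi : R), pi[%classic.

Definition on_circle (R : realType)
    (mu : set (measurableTypeR R) -> \bar R) : Prop :=
  mu (~` circle (R := R)) = 0%E.

(* The map x |-> -x modulo 2 pi: the point -pi (that is, -1 on the circle) is
   fixed.                                                                     *)
Definition circle_opp (R : realType) (x : R) : R :=
  if x == - pi then - pi else - x.

Definition even_measure (R : realType)
    (mu : set (measurableTypeR R) -> \bar R) : Prop :=
  forall A : set (measurableTypeR R), measurable A ->
    mu (@circle_opp R @^-1` A) = mu A.

(* The integral of a complex-valued function with respect to mu / (2 pi). *)
Definition circle_int (R : realType)
    (mu : {finite_measure set (measurableTypeR R) -> \bar R})
    (f : R -> R[i]) : R[i] :=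
  ((2 * pi)^-1 : R)%:C *
  ((\int[mu]_(x in circle (R := R)) complex.Re (f x))%R +i*
   (\int[mu]_(x in circle (R := R)) complex.Im (f x))%R).

Definition moment (R : realType)
    (mu : {finite_measure set (measurableTypeR R) -> \bar R})
    (k : int) : R[i] :=
  circle_int mu (fun x => expi (- (k%:~R * x))).

Definition circle_dot (R : realType)
    (mu : {finite_measure set (measurableTypeR R) -> \bar R})
    (p q : {poly R[i]}) : R[i] :=
  circle_int mu (fun x => p.[expi x] * (q.[expi x])^*).

(* [gram_schmidt mu n] lists the first n polynomials that the Gram-Schmidt
   process produces from 1, z, z^2, ... If the support of mu is finite, then
   a zero vector is eventually reached and, as 0^-1 = 0, the corresponding
   polynomial is 0.                                                           *)
Fixpoint gram_schmidt (R : realType)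
    (mu : {finite_measure set (measurableTypeR R) -> \bar R})
    (n : nat) : seq {poly R[i]} :=
  if n is m.+1 then
    let s := gram_schmidt mu m in
    let q : {poly R[i]} := 'X^m - \sum_(p <- s) circle_dot mu 'X^m p *: p in
    rcons s ((sqrtC (circle_dot mu q q))^-1 *: q)
  else [::].

Definition orthonormal_poly (R : realType)
    (mu : {finite_measure set (measurableTypeR R) -> \bar R})
    (n : nat) : {poly R[i]} :=
  nth 0 (gram_schmidt mu n.+1) n.

Definition nmoment (R : realType)
    (mu : {finite_measure set (measurableTypeR R) -> \bar R})
    (k : int) : R[i] :=
  moment mu k / moment mu 0.

(* [toeplitz_mx mu n] has size n: it is the matrix J_{n-1}. *)
Definition toeplitz_mx (R : realType)
    (mu : {finite_measure set (measurableTypeR R) -> \bar R})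
    (n : nat) : 'M[R[i]]_n :=
  \matrix_(i < n, j < n) nmoment mu (j%:Z - i%:Z).

Definition moment_up (R : realType)
    (mu : {finite_measure set (measurableTypeR R) -> \bar R})
    (n : nat) : 'cV[R[i]]_n :=
  \col_(i < n) nmoment mu (i.+1)%:Z.

Definition moment_down (R : realType)
    (mu : {finite_measure set (measurableTypeR R) -> \bar R})
    (n : nat) : 'cV[R[i]]_n :=
  \col_(i < n) nmoment mu (n%:Z - i%:Z).

Definition moment_Delta (R : realType)
    (mu : {finite_measure set (measurableTypeR R) -> \bar R})
    (n : nat) : R[i] :=
  1 - ((moment_up mu n)^T *m invmx (toeplitz_mx mu n) *m moment_up mu n) 0 0.

Definition moment_D (R : realType)
    (mu : {finite_measure set (measurableTypeR R) -> \bar R})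
    (n : nat) : R[i] :=
  ((moment_up mu n)^T *m invmx (toeplitz_mx mu n) *m moment_down mu n) 0 0.

(* 1 - (1, ..., 1) J_{n-1}^{-1} u_n, the value at 1 of the monic orthogonal
   polynomial of degree n. With Delta = moment_Delta mu n, D = moment_D mu n
   and P = moment_P mu n, the normalized h_{n+1} is
   (P ^ 2 / Delta) (1 - a) / (1 + a) for a = (c_{n+1} / c_0 - D) / Delta.
   Solving for c_{n+1} / c_0 gives the denominator h_{n+1} + P ^ 2 / Delta, in
   which h_{n+1} has no factor Delta.                                         *)
Definition moment_P (R : realType)
    (mu : {finite_measure set (measurableTypeR R) -> \bar R})
    (n : nat) : R[i] :=
  1 - ((const_mx 1 : 'rV[R[i]]_n) *m invmx (toeplitz_mx mu n)
         *m moment_up mu n) 0 0.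

(* Main.v *)
(** Let q_n be the monic orthogonal polynomial of degree n, E_n its squared norm
    and q_n^* the polynomial with the coefficients of q_n in reverse order. As
    the moments are real and even, q_n^* is orthogonal to z, ..., z^n and
    <q_n^*, 1> = E_n. Hence z q_n - a q_n^* with a = <z q_n, 1> / E_n is monic and
    orthogonal to 1, ..., z^n, that is, it is q_(n+1) (Szego's recurrence), and
    E_(n+1) = E_n (1 - a^2). Evaluating at 1,
    h_(n+1) = (q_n(1)^2 / E_n) (1 - a) / (1 + a). The coefficients of q_n and of
    q_n^* solve Toeplitz systems, which gives E_n = c_0 Delta_n, q_n(1) = P_n and
    <z q_n, 1> = c_(n+1) - c_0 D_n. It remains to solve for c_(n+1). *)

Require Import Defs.
From HB Require Import structures.
From mathcomp Require Import all_boot all_order all_algebra.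
From mathcomp Require Import complex.
From mathcomp Require Import all_classical all_reals all_analysis.
From mathcomp Require Import measurable_realfun zify ring.

Set Implicit Arguments.
Unset Strict Implicit.
Unset Printing Implicit Defensive.
Import Order.TTheory GRing.Theory Num.Theory.
Import numFieldNormedType.Exports.
Local Open Scope ring_scope.
Local Open Scope complex_scope.

Local Notation circle_measure R :=
  {finite_measure set (measurableTypeR R) -> \bar R}.

(** * Integration on the circle *)

(** [circle_int] is assembled from two real integrals, so its linearity rests on the integrability
    of both parts. *)
Definition circle_integrable {R : realType} (mu : circle_measure R)
    (f : R -> R[i]) : Prop :=
  mu.-integrable (@circle R) (EFin \o (fun x => complex.Re (f x))) /\
  mu.-integrable (@circle R) (EFin \o (fun x => complex.Im (f x))).

Lemma conjE {R : realType} (z : R[i]) : z^*%R = conjc z.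
Proof. by []. Qed.

Lemma measurable_circle {R : realType} : measurable (@circle R).
Proof. exact: measurable_itv. Qed.

Lemma expiD {R : realType} (x y : R) : expi (x + y) = expi x * expi y.
Proof.
rewrite /expi cosD sinD; simpc.
by congr (_ +i* _); rewrite addrC.
Qed.

Lemma expi0 {R : realType} : expi (0 : R) = 1.
Proof. by rewrite /expi cos0 sin0. Qed.

Lemma expiN {R : realType} (x : R) : expi (- x) = (expi x)^*%R.
Proof. by rewrite conjE /expi cosN sinN. Qed.

Lemma expi_unit {R : realType} (x : R) : expi x * (expi x)^*%R = 1.
Proof. by rewrite -expiN -expiD subrr expi0. Qed.

Lemma expiMn {R : realType} (n : nat) (x : R) :
  expi (n%:R * x) = expi x ^+ n.
Proof.
by elim: n => [|n IHn];
  rewrite ?mul0r ?expi0// -natr1 mulrDl mul1r expiD IHn exprSr.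
Qed.

(** A bounded measurable function is integrable for a finite measure. The domain is the whole line
    because the change of variable by [circle_opp] takes place there; [f] will be [cos] or [sin]. *)
Lemma integrable_bounded_continuous {R : realType} (mu : circle_measure R)
    (f : R -> R) (k : R) :
  continuous f -> (forall x, `|f x| <= 1) ->
  mu.-integrable setT (EFin \o (fun x => f (k * x))).
Proof.
move=> cf f1; apply: measurable_bounded_integrable => //.
- by rewrite ltey_eq fin_num_measure.
- apply: measurable_funTS.
  apply: (@measurableT_comp _ _ _ _ _ (measurableTypeR R) f).
    exact: continuous_measurable_fun.
  exact: measurable_funM.
- by exists 1; split=> // M M1 x _; apply: le_trans (ltW M1); exact: f1.
Qed.

Lemma circle_integrable_expi {R : realType} (mu : circle_measure R) (k : R) :
  circle_integrable mu (fun x => expi (k * x)).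
Proof.
have mC := @measurable_circle R.
by split; apply: (integrableS measurableT mC) => //;
  [ exact: (@integrable_bounded_continuous _ mu _ _ (@continuous_cos R)
    (@cos_max R))
  | exact: (@integrable_bounded_continuous _ mu _ _ (@continuous_sin R)
    (@sin_max R))].
Qed.

Lemma circle_integrable_scale {R : realType} (mu : circle_measure R)
    (f : R -> R) (c : R) :
  mu.-integrable (@circle R) (EFin \o f) ->
  mu.-integrable (@circle R) (EFin \o (fun x => c * f x)).
Proof. exact: (integrableZl measurable_circle c). Qed.

Lemma circle_integrableZD {R : realType} (mu : circle_measure R) (a : R[i])
    (f g : R -> R[i]) :
  circle_integrable mu f -> circle_integrable mu g ->
  circle_integrable mu (fun x => a * f x + g x).
Proof.
case: a => a b [f1 f2] [g1 g2]; have mC := @measurable_circle R.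
have ZI := @circle_integrable_scale R mu.
split.
- have := integrableD mC (integrableB mC (ZI _ a f1) (ZI _ b f2)) g1.
  by congr integrable; apply/funext => x; rewrite /=;
    case: (f x) (g x) => ? ? [? ?].
- have := integrableD mC (integrableD mC (ZI _ a f2) (ZI _ b f1)) g2.
  by congr integrable; apply/funext => x; rewrite /=;
    case: (f x) (g x) => ? ? [? ?].
Qed.

Lemma circle_intZD {R : realType} (mu : circle_measure R) (a : R[i])
    (f g : R -> R[i]) :
  circle_integrable mu f -> circle_integrable mu g ->
  circle_int mu (fun x => a * f x + g x) =
    a * circle_int mu f + circle_int mu g.
Proof.
case: a => a b [f1 f2] [g1 g2]; have mC := @measurable_circle R.
have ZI := @circle_integrable_scale R mu.
rewrite /circle_int mulrCA -mulrDr; congr (_ * _).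
rewrite (@eq_Rintegral _ _ _ mu _
  (fun x => (a * complex.Re (f x) - b * complex.Im (f x)) + complex.Re (g x)));
    last first.
  by move=> x _; case: (f x) (g x) => ? ? [? ?].
rewrite [X in _ +i* X = _](@eq_Rintegral _ _ _ mu _
  (fun x => (a * complex.Im (f x) + b * complex.Re (f x)) + complex.Im (g x)));
    last first.
  by move=> x _; case: (f x) (g x) => ? ? [? ?].
have iRe := integrableB mC (ZI _ a f1) (ZI _ b f2).
have iIm := integrableD mC (ZI _ a f2) (ZI _ b f1).
by rewrite (RintegralD mC iRe g1) (RintegralD mC iIm g2)
  (RintegralB mC (ZI _ a f1) (ZI _ b f2))
    (RintegralD mC (ZI _ a f2) (ZI _ b f1))
  !RintegralZl.
Qed.

Lemma circle_int_conj {R : realType} (mu : circle_measure R) (f : R -> R[i]) :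
  circle_integrable mu f ->
  circle_int mu (fun x => (f x)^*%R) = (circle_int mu f)^*%R.
Proof.
move=> [_ f2]; rewrite /circle_int rmorphM /= !conjE /= oppr0; congr (_ * _).
rewrite (@eq_Rintegral _ _ _ mu _ (fun x => complex.Re (f x)));
  last by move=> x _; rewrite conjE; case: (f x).
rewrite [X in _ +i* X = _](@eq_Rintegral _ _ _ mu _ (fun x => -1 * complex.Im (f x))); last first.
  by move=> x _; case: (f x) => ? ?; rewrite conjE mulN1r.
by rewrite RintegralZl ?mulN1r //; exact: measurable_circle.
Qed.

Lemma circle_int_ge0 {R : realType} (mu : circle_measure R) (f : R -> R[i]) :
  (forall x, 0 <= f x) -> 0 <= circle_int mu f.
Proof.
move=> f0; apply: mulr_ge0.
  by rewrite ler0c invr_ge0 mulr_ge0 // pi_ge0.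
(* In the order of [R[i]] a nonnegative number is real, so the imaginary part integrates to 0. *)
rewrite [X in _ +i* X](@eq_Rintegral _ _ _ mu _ (fun=> 0)); last by move=> x _;
  rewrite ger0_Im.
rewrite Rintegral_cst ?mul0r; last exact: measurable_circle.
rewrite lecE /= eqxx; apply: Rintegral_ge0 => x _.
by have := f0 x; rewrite lecE => /andP[].
Qed.

(** * Evenness of the measure and of its moments *)

Lemma measurable_circle_opp {R : realType} :
  measurable_fun setT (@circle_opp R : measurableTypeR R -> measurableTypeR R).
Proof.
apply: measurable_fun_ifT => //.
by apply: measurable_fun_eqr.
Qed.

(** The complement of the circle is negligible. This links [circle_int], restricted to the circle,
    with integrals over the line, where pushforwards are available. *)
Lemma Rintegral_on_circle {R : realType} (mu : circle_measure R) (f : R -> R) :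
  on_circle mu -> mu.-integrable setT (EFin \o f) ->
  \int[mu]_(x in @circle R) f x = \int[mu]_x f x.
Proof.
move=> mu_circle intf; have mC := @measurable_circle R; congr fine.
rewrite (@negligible_integral _ _ _ mu setT (~` @circle R)%classic) //.
  by rewrite setTD setCK.
exact: measurableC.
Qed.

(* [circle_opp] also sends pi, which is not in [circle], to -pi: hence the
   hypothesis [on_circle], which makes {pi} negligible. *)
Lemma Rintegral_circle_opp {R : realType} (mu : circle_measure R) (f : R -> R) :
  on_circle mu -> even_measure mu -> mu.-integrable setT (EFin \o f) ->
  \int[mu]_(x in @circle R) f (circle_opp x) = \int[mu]_(x in @circle R) f x.
Proof.
move=> mu_circle mu_even intf.
have mopp := @measurable_circle_opp R.
have mf : measurable_fun setT (EFin \o f) := measurable_int mu intf.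
have intfopp : mu.-integrable setT (EFin \o (fun x => f (circle_opp x))).
  apply/integrableP; split; first exact: (measurableT_comp mf mopp).
  have /integrableP[_] := intf; congr (_ < _)%E.
  (* Evenness says that the pushforward of [mu] under [circle_opp] is [mu] itself. *)
  rewrite -[RHS](@ge0_integral_pushforward _ _ _ _ _ _ mopp mu setT
    (fun x => `|(f x)%:E|%E)) //.
    by apply: eq_measure_integral => A mA _; exact/esym/mu_even.
  exact: measurableT_comp.
rewrite !Rintegral_on_circle //; congr fine.
rewrite -[LHS](@integral_pushforward _ _ _ _ _ _ mopp mu setT (EFin \o f)) //.
by apply: eq_measure_integral => A mA _; exact: mu_even.
Qed.

Lemma sin_natmul_pi {R : realType} (n : nat) : sin (n%:R * pi) = 0 :> R.
Proof.
elim: n => [|n IHn]; first by rewrite mul0r sin0.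
by rewrite -natr1 mulrDl mul1r sinDpi IHn oppr0.
Qed.

Lemma sin_intmul_pi {R : realType} (k : int) : sin (k%:~R * pi) = 0 :> R.
Proof.
case: k => n; first exact: sin_natmul_pi.
by rewrite NegzE mulrNz mulNr sinN sin_natmul_pi oppr0.
Qed.

Lemma moment_even {R : realType} (mu : circle_measure R) (k : int) :
  on_circle mu -> even_measure mu -> moment mu (- k) = moment mu k.
Proof.
move=> mu_circle mu_even; rewrite /moment /circle_int; congr (_ * (_ +i* _)).
  by apply: eq_Rintegral => x _ /=; rewrite mulrNz mulNr opprK cosN.
rewrite [RHS](@eq_Rintegral _ _ _ mu _ (fun x => sin (k%:~R * circle_opp x))).
  rewrite [RHS](@Rintegral_circle_opp _ mu (fun x => sin (k%:~R * x))) //.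
    by apply: eq_Rintegral => x _ /=; rewrite mulrNz mulNr opprK.
  exact: (@integrable_bounded_continuous _ mu _ _ (@continuous_sin R)
    (@sin_max R)).
(* At the fixed point -pi the map is not x |-> -x, but both sines vanish there since k is an
   integer. *)
move=> x _ /=; rewrite /circle_opp; case: eqP => [->|_]; last by rewrite mulrN.
by rewrite mulrN opprK sinN sin_intmul_pi oppr0.
Qed.

(** * Integrability of products of polynomials *)

Lemma circle_integrable0 {R : realType} (mu : circle_measure R) :
  circle_integrable mu (fun=> 0).
Proof.
have E := circle_integrable_expi mu 0.
have := @circle_integrableZD _ mu (-1) _ _ E E; congr circle_integrable.
by apply/funext => x; rewrite mulN1r addNr.
Qed.

Lemma circle_integrable_poly {R : realType} (mu : circle_measure R)
    (p q : {poly R[i]}) :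
  circle_integrable mu (fun x => p.[expi x] * (q.[expi x])^*%R).
Proof.
(* The extra factor [expi (k * x)] strengthens the claim for induction: splitting off a factor z of
   [p] raises k by 1, splitting one off [q], which is conjugated, lowers it by 1. *)
suff H k : circle_integrable mu
  (fun x => expi (k * x) * (p.[expi x] * (q.[expi x])^*%R)).
  by have := H 0; congr circle_integrable; apply/funext => x;
    rewrite mul0r expi0 mul1r.
elim/poly_ind: p k => [|p c IHp] k.
  have := circle_integrable0 mu; congr circle_integrable.
  by apply/funext => x; rewrite horner0 mul0r mulr0.
suff H : circle_integrable mu (fun x => expi (k * x) * (q.[expi x])^*%R).
  have := @circle_integrableZD _ mu c _ _ H (IHp (k + 1));
    congr circle_integrable.
  by apply/funext => x; rewrite mulrDl mul1r expiD hornerMXaddC; ring.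
elim/poly_ind: q k {p IHp c} => [|q c IHq] k.
  have := circle_integrable0 mu; congr circle_integrable.
  by apply/funext => x; rewrite horner0 rmorph0 mulr0.
have := @circle_integrableZD _ mu c^*%R _ _ (circle_integrable_expi mu k)
  (IHq (k - 1)).
congr circle_integrable; apply/funext => x.
by rewrite mulrBl mul1r expiD expiN hornerMXaddC rmorphD rmorphM /=; ring.
Qed.

(** * The inner product on polynomials *)

Lemma circle_dotZD {R : realType} (mu : circle_measure R) (a : R[i])
    (p q r : {poly R[i]}) :
  circle_dot mu (a *: p + q) r = a * circle_dot mu p r + circle_dot mu q r.
Proof.
rewrite /circle_dot -circle_intZD; do ?exact: circle_integrable_poly.
by congr circle_int; apply/funext => x; rewrite hornerD hornerZ mulrDl mulrA.
Qed.

Lemma circle_dot_conj {R : realType} (mu : circle_measure R) (p q : {poly R[i]}) :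
  (circle_dot mu p q)^*%R = circle_dot mu q p.
Proof.
rewrite /circle_dot -circle_int_conj; last exact: circle_integrable_poly.
by congr circle_int; apply/funext => x; rewrite rmorphM /= conjCK mulrC.
Qed.

Lemma circle_dot_ge0 {R : realType} (mu : circle_measure R) (p : {poly R[i]}) :
  0 <= circle_dot mu p p.
Proof. by apply: circle_int_ge0 => x; exact: mul_conjC_ge0. Qed.

Lemma circle_dotX {R : realType} (mu : circle_measure R) (i j : nat) :
  circle_dot mu 'X^i 'X^j = moment mu (j%:Z - i%:Z).
Proof.
congr circle_int; apply/funext => x.
rewrite !hornerXn rmorphXn /= -expiN -!expiMn -expiD; congr expi.
by rewrite rmorphB /= -!pmulrn; ring.
Qed.

Lemma circle_dotZl {R : realType} (mu : circle_measure R) (a : R[i])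
    (p r : {poly R[i]}) :
  circle_dot mu (a *: p) r = a * circle_dot mu p r.
Proof.
have d0 : circle_dot mu 0 r = 0.
  have := circle_dotZD mu 1 0 0 r; rewrite scaler0 addr0 mul1r.
  by move=> /esym/eqP; rewrite -subr_eq0 addrK => /eqP.
by have := circle_dotZD mu a p 0 r; rewrite addr0 d0 addr0.
Qed.

Lemma circle_dotDl {R : realType} (mu : circle_measure R) (p q r : {poly R[i]}) :
  circle_dot mu (p + q) r = circle_dot mu p r + circle_dot mu q r.
Proof. by have := circle_dotZD mu 1 p q r; rewrite scale1r mul1r. Qed.

Lemma circle_dot0l {R : realType} (mu : circle_measure R) (r : {poly R[i]}) :
  circle_dot mu 0 r = 0.
Proof. by rewrite -(scale0r 0) circle_dotZl mul0r. Qed.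

Lemma circle_dotBl {R : realType} (mu : circle_measure R) (p q r : {poly R[i]}) :
  circle_dot mu (p - q) r = circle_dot mu p r - circle_dot mu q r.
Proof. by rewrite circle_dotDl -scaleN1r circle_dotZl mulN1r. Qed.

Lemma circle_dot_suml {R : realType} (mu : circle_measure R) (n : nat)
    (F : nat -> {poly R[i]}) (r : {poly R[i]}) :
  circle_dot mu (\sum_(i < n) F i) r = \sum_(i < n) circle_dot mu (F i) r.
Proof.
elim: n => [|n IHn]; first by rewrite !big_ord0 circle_dot0l.
by rewrite !big_ord_recr /= circle_dotDl IHn.
Qed.

Lemma circle_dot_eq0C {R : realType} (mu : circle_measure R) (p q : {poly R[i]}) :
  circle_dot mu p q = 0 -> circle_dot mu q p = 0.
Proof. by move=> pq0; rewrite -circle_dot_conj pq0 rmorph0. Qed.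

Lemma circle_dotZr {R : realType} (mu : circle_measure R) (a : R[i])
    (p r : {poly R[i]}) :
  circle_dot mu p (a *: r) = a^*%R * circle_dot mu p r.
Proof. by rewrite -circle_dot_conj circle_dotZl rmorphM /= circle_dot_conj. Qed.

(** Multiplication by z is an isometry, as z has modulus 1 on the circle. *)
Lemma circle_dotMX {R : realType} (mu : circle_measure R) (p q : {poly R[i]}) :
  circle_dot mu ('X * p) ('X * q) = circle_dot mu p q.
Proof.
congr circle_int; apply/funext => x.
by rewrite !hornerM !hornerX rmorphM mulrACA expi_unit mul1r.
Qed.

Lemma poly_sumX {A : nzRingType} (p : {poly A}) (n : nat) :
  (size p <= n)%N -> p = \sum_(i < n) p`_i *: 'X^i.
Proof.
move=> pn; rewrite -poly_def; apply/polyP => i; rewrite coef_poly.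
by case: ltnP => // ni; rewrite nth_default // (leq_trans pn).
Qed.

Lemma circle_dot_coef {R : realType} (mu : circle_measure R) (p : {poly R[i]})
    (n k : nat) : (size p <= n)%N ->
  circle_dot mu p 'X^k = \sum_(i < n) p`_i * moment mu (k%:Z - i%:Z).
Proof.
move=> pn; rewrite {1}(poly_sumX pn).
rewrite (circle_dot_suml mu n (fun i => p`_i *: 'X^i)); apply: eq_bigr => i _.
by rewrite circle_dotZl circle_dotX.
Qed.

Lemma circle_dot_low {R : realType} (mu : circle_measure R) (q p : {poly R[i]})
    (n : nat) :
  (forall k, (k < n)%N -> circle_dot mu q 'X^k = 0) -> (size p <= n)%N ->
  circle_dot mu q p = 0.
Proof.
move=> qX pn; apply: circle_dot_eq0C.
rewrite (poly_sumX pn).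
rewrite (circle_dot_suml mu n (fun i => p`_i *: 'X^i)) big1 // => i _.
by rewrite circle_dotZl (circle_dot_eq0C (qX i _)) ?mulr0.
Qed.

(** * Monic orthogonal polynomials *)

(** The vector [q] of the Gram-Schmidt step, before normalization. *)
Definition monic_op {R : realType} (mu : circle_measure R) (n : nat) :
    {poly R[i]} :=
  'X^n - \sum_(p <- gram_schmidt mu n) circle_dot mu 'X^n p *: p.

(* Equivalently, the support of [mu] is infinite. *)
Definition nondegenerate {R : realType} (mu : circle_measure R) : Prop :=
  forall k, circle_dot mu (monic_op mu k) (monic_op mu k) != 0.

Lemma size_gram_schmidt {R : realType} (mu : circle_measure R) (n : nat) :
  size (gram_schmidt mu n) = n.
Proof. by elim: n => //= n IHn; rewrite size_rcons IHn. Qed.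

Lemma orthonormal_polyE {R : realType} (mu : circle_measure R) (n : nat) :
  orthonormal_poly mu n =
  (sqrtC (circle_dot mu (monic_op mu n) (monic_op mu n)))^-1 *: monic_op mu n.
Proof. by rewrite /orthonormal_poly /= nth_rcons size_gram_schmidt ltnn eqxx.
  Qed.

Lemma gram_schmidtE {R : realType} (mu : circle_measure R) (n : nat) :
  gram_schmidt mu n = mkseq (orthonormal_poly mu) n.
Proof.
elim: n => [//|n IHn]; rewrite mkseqS -IHn orthonormal_polyE.
by [].
Qed.

Lemma monic_opE {R : realType} (mu : circle_measure R) (n : nat) :
  monic_op mu n = 'X^n -
    \sum_(i < n) circle_dot mu 'X^n (orthonormal_poly mu i) *: orthonormal_poly
      mu i.
Proof.
rewrite /monic_op gram_schmidtE big_map.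
by rewrite [iota 0 n](_ : _ = index_iota 0 n) ?big_mkord // /index_iota subn0.
Qed.

Lemma monic_op0 {R : realType} (mu : circle_measure R) : monic_op mu 0 = 1.
Proof. by rewrite monic_opE big_ord0 subr0 expr0. Qed.

(** Only polynomials of degree below n are subtracted from z^n. This form gives both the degree
    bound and the leading coefficient 1. *)
Lemma size_monic_op_low {R : realType} (mu : circle_measure R) (n : nat) :
  (size (monic_op mu n - 'X^n)%R <= n)%N.
Proof.
elim/ltn_ind: n => n IHn.
rewrite {1}monic_opE addrAC subrr add0r size_polyN.
apply: (leq_trans (size_sum _ _ _)); apply/bigmax_leqP => i _.
apply: (leq_trans (size_scale_leq _ _)).
rewrite orthonormal_polyE; apply: (leq_trans (size_scale_leq _ _)).
rewrite -[monic_op mu i](subrK 'X^i); apply: (leq_trans (size_polyD _ _)).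
rewrite size_polyXn geq_max ltn_ord andbT.
exact: leq_trans (IHn _ (ltn_ord i)) (ltnW (ltn_ord i)).
Qed.

Lemma size_monic_op {R : realType} (mu : circle_measure R) (n : nat) :
  (size (monic_op mu n) <= n.+1)%N.
Proof.
rewrite -[monic_op mu n](subrK 'X^n); apply: (leq_trans (size_polyD _ _)).
by rewrite size_polyXn geq_max leqnn andbT leqW // size_monic_op_low.
Qed.

Lemma coef_monic_op {R : realType} (mu : circle_measure R) (n : nat) :
  (monic_op mu n)`_n = 1.
Proof.
rewrite -[monic_op mu n](subrK 'X^n) coefD coefXn eqxx.
by rewrite nth_default ?add0r // size_monic_op_low.
Qed.

Lemma circle_dot_orthonormal_poly {R : realType} (mu : circle_measure R)
    (n : nat) :
  circle_dot mu (monic_op mu n) (monic_op mu n) != 0 ->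
  circle_dot mu (orthonormal_poly mu n) (orthonormal_poly mu n) = 1.
Proof.
move=> dn0; have d0 := circle_dot_ge0 mu (monic_op mu n).
rewrite orthonormal_polyE circle_dotZl circle_dotZr.
set d := circle_dot _ _ _ in dn0 d0 *.
have s0 : sqrtC d != 0 by rewrite sqrtC_eq0.
(* The square root of a nonnegative number is real, so its conjugation drops out. *)
rewrite fmorphV /= (CrealP _); last by rewrite ger0_real // sqrtC_ge0.
by rewrite -{3}[d]sqrtCK; field.
Qed.

Lemma monic_op_scale {R : realType} (mu : circle_measure R) (n : nat) :
  circle_dot mu (monic_op mu n) (monic_op mu n) != 0 ->
  monic_op mu n = sqrtC (circle_dot mu (monic_op mu n) (monic_op mu n)) *:
    orthonormal_poly mu n.
Proof.
move=> dn0; rewrite orthonormal_polyE scalerA divff ?scale1r //.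
by rewrite sqrtC_eq0.
Qed.

(** Strong induction on n: the earlier polynomials are mutually orthonormal, so pairing with the
    i-th one leaves a single term of the sum, which cancels the pairing with z^n. *)
Lemma monic_op_orthonormal_poly {R : realType} (mu : circle_measure R)
    (n i : nat) :
  nondegenerate mu ->
  (i < n)%N -> circle_dot mu (monic_op mu n) (orthonormal_poly mu i) = 0.
Proof.
move=> dn0; elim/ltn_ind: n i => n IHn i ni.
rewrite {1}monic_opE circle_dotBl.
rewrite (circle_dot_suml mu n
  (fun l => circle_dot mu 'X^n (orthonormal_poly mu l) *: orthonormal_poly mu
    l)).
rewrite (bigD1 (Ordinal ni)) //= circle_dotZl circle_dot_orthonormal_poly //
  mulr1.
rewrite big1 ?addr0 ?subrr // => l /eqP li.
have orth a b : (a < b)%N -> (b < n)%N ->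
    circle_dot mu (orthonormal_poly mu b) (orthonormal_poly mu a) = 0.
  by move=> ab bn; rewrite [orthonormal_poly mu b]orthonormal_polyE circle_dotZl
    IHn ?mulr0.
rewrite circle_dotZl; case: (ltngtP l i) => [lti|gti|eqi].
- by rewrite (circle_dot_eq0C (orth _ _ lti ni)) mulr0.
- by rewrite orth ?mulr0.
- by case: li; apply: val_inj.
Qed.

(** z^k is [monic_op mu k] plus a combination of orthonormal polynomials of smaller index, all of
    them orthogonal to [monic_op mu n]. *)
Lemma monic_op_orthX {R : realType} (mu : circle_measure R) (n k : nat) :
  nondegenerate mu ->
  (k < n)%N -> circle_dot mu (monic_op mu n) 'X^k = 0.
Proof.
move=> dn0 kn; apply: circle_dot_eq0C.
have -> : 'X^k = monic_op mu k +
    \sum_(i < k) circle_dot mu 'X^k (orthonormal_poly mu i) *: orthonormal_poly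
      mu i.
  by rewrite {1}monic_opE subrK.
rewrite circle_dotDl (circle_dot_suml mu k
  (fun l => circle_dot mu 'X^k (orthonormal_poly mu l) *: orthonormal_poly mu
    l)).
rewrite monic_op_scale // circle_dotZl
  (circle_dot_eq0C (monic_op_orthonormal_poly dn0 kn)) mulr0 add0r.
rewrite big1 // => i _;
  rewrite circle_dotZl (circle_dot_eq0C (monic_op_orthonormal_poly dn0 _))
    ?mulr0 //.
exact: ltn_trans kn.
Qed.

Lemma circle_dot_monic_opX {R : realType} (mu : circle_measure R) (n : nat) :
  nondegenerate mu ->
  circle_dot mu (monic_op mu n) 'X^n =
    circle_dot mu (monic_op mu n) (monic_op mu n).
Proof.
move=> dn0; rewrite -[LHS]circle_dot_conj -[RHS]circle_dot_conj; congr Num.conj.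
apply/eqP; rewrite eq_sym -subr_eq0 -circle_dotBl; apply/eqP/circle_dot_eq0C.
exact: circle_dot_low (fun k => @monic_op_orthX _ mu n k dn0)
  (size_monic_op_low mu n).
Qed.

(** If p had degree m < n, it would be orthogonal to [monic_op mu m]. But [monic_op mu m] kills the
    terms of p below z^m, so the pairing is the leading coefficient times a nonzero squared norm. *)
Lemma circle_dot_nondegenerate {R : realType} (mu : circle_measure R) (n : nat)
    (p : {poly R[i]}) :
  nondegenerate mu ->
  (size p <= n)%N -> (forall k, (k < n)%N -> circle_dot mu p 'X^k = 0) -> p = 0.
Proof.
move=> dn0 pn pX; apply/eqP/negPn/negP => p0.
have sp : (0 < size p)%N by rewrite size_poly_gt0.
set m := (size p).-1; have mE : size p = m.+1 by rewrite prednK.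
have : circle_dot mu p (monic_op mu m) = 0.
  apply: circle_dot_low pX _; apply: leq_trans (size_monic_op _ _) _.
  by rewrite -mE.
move/circle_dot_eq0C; have -> : p =
  (p - lead_coef p *: 'X^m) + lead_coef p *: 'X^m by rewrite subrK.
move/circle_dot_eq0C; rewrite circle_dotDl circle_dotZl.
rewrite (circle_dot_eq0C (@circle_dot_low _ mu _ _ m _ _)); last 2 first.
- by move=> k; exact: monic_op_orthX.
- apply/leq_sizeP => j;
  rewrite leq_eqVlt coefB coefZ coefXn => /orP[/eqP <-|mj].
    by rewrite eqxx mulr1 /lead_coef subrr.
  by rewrite gtn_eqF // mulr0 subr0 nth_default // mE.
rewrite add0r -circle_dot_conj circle_dot_monic_opX // circle_dot_conj => /eqP.
by rewrite mulf_eq0 lead_coef_eq0 (negbTE p0) (negbTE (dn0 m)).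
Qed.

(** The difference of two candidates has degree below n and is orthogonal to all lower powers, hence
    is 0. *)
Lemma monic_op_unique {R : realType} (mu : circle_measure R) (n : nat)
    (p : {poly R[i]}) :
  nondegenerate mu ->
  (size (p - 'X^n)%R <= n)%N ->
  (forall k, (k < n)%N -> circle_dot mu p 'X^k = 0) ->
  p = monic_op mu n.
Proof.
move=> dn0 pn pX; apply/eqP; rewrite -subr_eq0; apply/eqP.
apply: (@circle_dot_nondegenerate _ mu n) => // [|k kn]; last first.
  by rewrite circle_dotBl pX // monic_op_orthX // subrr.
rewrite (_ : p - _ = (p - 'X^n) - (monic_op mu n - 'X^n)); last by ring.
by rewrite (leq_trans (size_polyD _ _)) // size_polyN geq_max pn
  size_monic_op_low.
Qed.

(** * Szego's recurrence *)

(** Conjugating <1, z^n> swaps its arguments, which turns c_n into c_(-n), equal to c_n by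
    evenness. *)
Lemma moment_real {R : realType} (mu : circle_measure R) (k : int) :
  on_circle mu -> even_measure mu -> (moment mu k)^*%R = moment mu k.
Proof.
move=> muC muE.
have H (n : nat) : (moment mu n)^*%R = moment mu n.
  have := circle_dot_conj mu 'X^0 'X^n.
  by rewrite !circle_dotX subr0 sub0r moment_even.
by case: k => n; rewrite ?NegzE ?moment_even.
Qed.

(** The usual reversed polynomial also conjugates the coefficients; for an even nondegenerate
    measure they are real, by [monic_op_real]. *)
Definition reversed_op {R : realType} (mu : circle_measure R) (n : nat) :
    {poly R[i]} :=
  \poly_(i < n.+1) (monic_op mu n)`_(n - i).

Lemma horner1_monic_op {R : realType} (mu : circle_measure R) (n : nat) :
  (monic_op mu n).[1] = (reversed_op mu n).[1].
Proof.
rewrite (horner_coef_wide _ (size_monic_op mu n)) horner_poly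
  (reindex_inj rev_ord_inj) /=.
by apply: eq_bigr => i _; rewrite !expr1n subSS.
Qed.

Lemma circle_dot_reversed_op {R : realType} (mu : circle_measure R) (n k : nat) :
  circle_dot mu (reversed_op mu n) 'X^k =
  \sum_(i < n.+1) (monic_op mu n)`_i * moment mu (k%:Z - n%:Z + i%:Z).
Proof.
rewrite (circle_dot_coef _ _ (size_poly _ _)) (reindex_inj rev_ord_inj) /=.
apply: eq_bigr => i _; have := ltn_ord i; rewrite ltnS => ile.
rewrite coef_poly subSS ltnS leq_subr subKn //; congr (_ * moment _ _).
by rewrite -subzn //; ring.
Qed.

(** Reversing the coefficients negates the indices of the moments in the sum, which evenness
    absorbs. *)
Lemma reversed_op_orthX {R : realType} (mu : circle_measure R) (n k : nat) :
  on_circle mu -> even_measure mu -> (k <= n)%N ->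
  circle_dot mu (reversed_op mu n) 'X^k =
    circle_dot mu (monic_op mu n) 'X^(n - k).
Proof.
move=> muC muE kn; rewrite circle_dot_reversed_op
  (circle_dot_coef _ _ (size_monic_op _ _)).
apply: eq_bigr => i _; rewrite -moment_even //; congr (_ * moment _ _).
by rewrite -subzn //; ring.
Qed.

Lemma reversed_op_dotXS {R : realType} (mu : circle_measure R) (n : nat) :
  on_circle mu -> even_measure mu ->
  circle_dot mu (reversed_op mu n) 'X^(n.+1) =
    circle_dot mu ('X * monic_op mu n) 1.
Proof.
move=> muC muE; rewrite circle_dot_reversed_op -(expr0 'X).
have sX : (size ('X * monic_op mu n)%R <= n.+2)%N.
  by rewrite (leq_trans (size_polyMleq _ _)) // size_polyX /= ltnS
    size_monic_op.
rewrite (circle_dot_coef _ _ sX) [RHS]big_ord_recl coefXM /= mul0r add0r.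
apply: eq_bigr => i _; rewrite coefXM /= -moment_even //;
  congr (_ * moment _ _).
by rewrite /bump /=; lia.
Qed.

(** For an even nondegenerate measure, Szego's recurrence at 0 shows that this is -q_(n+1)(0), the
    Verblunsky coefficient. *)
Definition verblunsky {R : realType} (mu : circle_measure R) (n : nat) : R[i] :=
  circle_dot mu ('X * monic_op mu n) 1 / circle_dot mu (monic_op mu n)
    (monic_op mu n).

Lemma szego_recurrence {R : realType} (mu : circle_measure R) (n : nat) :
  on_circle mu -> even_measure mu -> nondegenerate mu ->
  monic_op mu n.+1 = 'X * monic_op mu n - verblunsky mu n *: reversed_op mu n.
Proof.
move=> muC muE dn0; apply/esym/monic_op_unique => //.
- rewrite addrAC exprS -mulrBr (leq_trans (size_polyD _ _)) // geq_max.
  rewrite (leq_trans (size_polyMleq _ _)) ?size_polyX ?ltnS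
    ?size_monic_op_low //=.
  by rewrite size_polyN (leq_trans (size_scale_leq _ _)) // size_poly.
- case=> [_|k]; rewrite circle_dotBl circle_dotZl.
    (* Against 1 the two terms cancel by the choice of the coefficient. *)
    by rewrite expr0 -{2}(expr0 'X) reversed_op_orthX // subn0
      circle_dot_monic_opX // mulfVK ?subrr.
  (* Against z^(k+1) both terms vanish: they reduce to the pairings of q_n with z^k and with
     z^(n-k-1). *)
  rewrite ltnS => kn; rewrite exprS circle_dotMX monic_op_orthX // -exprS
    reversed_op_orthX //.
  by rewrite monic_op_orthX ?mulr0 ?subrr // ltn_subrL (leq_trans _ kn).
Qed.

(** Pair the recurrence with z^(n+1): the first term gives E_n, and the second a <z q_n, 1> = a^2
    E_n. *)
Lemma sqnorm_monic_opS {R : realType} (mu : circle_measure R) (n : nat) :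
  on_circle mu -> even_measure mu -> nondegenerate mu ->
  circle_dot mu (monic_op mu n.+1) (monic_op mu n.+1) =
  circle_dot mu (monic_op mu n) (monic_op mu n) * (1 - verblunsky mu n ^+ 2).
Proof.
move=> muC muE dn0; rewrite -circle_dot_monic_opX // szego_recurrence //.
rewrite circle_dotBl circle_dotZl reversed_op_dotXS // {1}exprS circle_dotMX
  circle_dot_monic_opX //.
by rewrite /verblunsky; field; exact: dn0.
Qed.

Lemma horner1_monic_opS {R : realType} (mu : circle_measure R) (n : nat) :
  on_circle mu -> even_measure mu -> nondegenerate mu ->
  (monic_op mu n.+1).[1] = (1 - verblunsky mu n) * (monic_op mu n).[1].
Proof.
move=> muC muE dn0; rewrite szego_recurrence // hornerD hornerN hornerZ hornerM
  hornerX.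
by rewrite -horner1_monic_op; ring.
Qed.

(** * Toeplitz systems *)

Lemma moment0_sqnorm {R : realType} (mu : circle_measure R) :
  circle_dot mu (monic_op mu 0) (monic_op mu 0) = moment mu 0.
Proof. by rewrite monic_op0 -(expr0 'X) circle_dotX subrr. Qed.

(** A row vector killed by the matrix lists the coefficients of a polynomial of degree below n
    orthogonal to 1, ..., z^(n-1), hence is 0. *)
Lemma toeplitz_mx_unit {R : realType} (mu : circle_measure R) (n : nat) :
  nondegenerate mu ->
  toeplitz_mx mu n \in unitmx.
Proof.
move=> dn0; rewrite -row_free_unit; apply: inj_row_free => v vJ0.
have m0 : moment mu 0 != 0 by rewrite -moment0_sqnorm.
pose p := rVpoly v.
suff p0 : p = 0 by rewrite -[v]rVpolyK -/p p0 linear0.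
apply: (circle_dot_nondegenerate dn0 (size_poly _ _)) => k kn.
rewrite (circle_dot_coef _ _ (size_poly _ _)).
have /(congr1 ( *%R (moment mu 0))) :=
  congr1 (fun M : 'rV_n => M 0 (Ordinal kn)) vJ0.
rewrite !mxE mulr0 => E; rewrite -[RHS]E mulr_sumr; apply: eq_bigr => i _.
by rewrite coef_rVpoly_ord !mxE /nmoment /=; field.
Qed.

(** These are the equations <q_n, z^k> = 0 for k < n; the leading coefficient 1 contributes the
    right-hand side. *)
Lemma monic_op_normal_eq {R : realType} (mu : circle_measure R) (n : nat) :
  on_circle mu -> even_measure mu -> nondegenerate mu ->
  invmx (toeplitz_mx mu n) *m moment_down mu n =
    - \col_(i < n) (monic_op mu n)`_i.
Proof.
move=> muC muE dn0; have Ju := toeplitz_mx_unit n dn0.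
have m0 : moment mu 0 != 0 by rewrite -moment0_sqnorm.
rewrite -[RHS](mulKmx Ju); congr (_ *m _).
apply/matrixP => k j; rewrite !mxE.
have := monic_op_orthX dn0 (ltn_ord k).
rewrite (circle_dot_coef _ _ (size_monic_op _ _)) big_ord_recr /= coef_monic_op
  mul1r.
move/eqP; rewrite addr_eq0 => /eqP E.
rewrite /nmoment -moment_even // opprB -[moment mu (k%:Z - n%:Z)]opprK -E mulNr
  mulr_suml -sumrN.
apply: eq_bigr => i _; rewrite !mxE /nmoment -moment_even // opprB.
by field.
Qed.

(** The equations are now <q_n^*, z^(k+1)> = 0 for k < n. The constant coefficient 1 contributes the
    right-hand side, whence the shifted index of the unknowns. *)
Lemma reversed_op_normal_eq {R : realType} (mu : circle_measure R) (n : nat) :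
  on_circle mu -> even_measure mu -> nondegenerate mu ->
  invmx (toeplitz_mx mu n) *m moment_up mu n =
    - \col_(i < n) (reversed_op mu n)`_i.+1.
Proof.
move=> muC muE dn0; have Ju := toeplitz_mx_unit n dn0.
have m0 : moment mu 0 != 0 by rewrite -moment0_sqnorm.
rewrite -[RHS](mulKmx Ju); congr (_ *m _).
apply/matrixP => k j; rewrite !mxE.
have kn : (n - k.+1 < n)%N by rewrite ltn_subrL (leq_trans _ (ltn_ord k)).
have := monic_op_orthX dn0 kn; rewrite -reversed_op_orthX //.
rewrite (circle_dot_coef _ _ (size_poly _ _)) big_ord_recl /= coef_poly subn0 /=
  coef_monic_op mul1r subr0.
move/eqP; rewrite addr_eq0 => /eqP E.
rewrite /nmoment E mulNr mulr_suml -sumrN.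
apply: eq_bigr => i _;
  rewrite !mxE /nmoment /bump /= -[moment mu (i%:Z - k%:Z)]moment_even //.
rewrite add1n (_ : k.+1%:Z - i.+1%:Z = - (i%:Z - k%:Z)); last by lia.
by field.
Qed.

(** Expand E_n = <q_n^*, 1> in moments: the constant coefficient gives c_0, the others the quadratic
    form in u_n. *)
Lemma moment_Delta_sqnorm {R : realType} (mu : circle_measure R) (n : nat) :
  on_circle mu -> even_measure mu -> nondegenerate mu ->
  circle_dot mu (monic_op mu n) (monic_op mu n) =
    moment mu 0 * moment_Delta mu n.
Proof.
move=> muC muE dn0.
have m0 : moment mu 0 != 0 by rewrite -moment0_sqnorm.
rewrite -circle_dot_monic_opX // -{2}(subn0 n) -reversed_op_orthX //.
rewrite (circle_dot_coef _ _ (size_poly _ _)) big_ord_recl coef_poly subn0 /=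
  coef_monic_op mul1r subr0.
rewrite /moment_Delta -mulmxA reversed_op_normal_eq // mulmxN !mxE opprK mulrDr
  mulr1; congr (_ + _).
rewrite mulr_sumr; apply: eq_bigr => i _;
  rewrite !mxE /nmoment /bump /= add1n sub0r moment_even //.
by field.
Qed.

(** Expand <z q_n, 1> = <q_n^*, z^(n+1)> in moments: the leading coefficient of q_n gives c_(n+1),
    the others -c_0 D_n. *)
Lemma moment_D_dot {R : realType} (mu : circle_measure R) (n : nat) :
  on_circle mu -> even_measure mu -> nondegenerate mu ->
  moment mu n.+1%:Z = moment mu 0 * moment_D mu n + circle_dot mu
    ('X * monic_op mu n) 1.
Proof.
move=> muC muE dn0.
have m0 : moment mu 0 != 0 by rewrite -moment0_sqnorm.
rewrite -reversed_op_dotXS // circle_dot_reversed_op big_ord_recr /=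
  coef_monic_op mul1r.
rewrite subrK addrA -[LHS]add0r; congr (_ + _).
rewrite /moment_D -mulmxA monic_op_normal_eq // mulmxN !mxE mulrN;
  apply/esym/eqP.
rewrite addrC subr_eq0; apply/eqP.
rewrite mulr_sumr; apply: eq_bigr => i _; rewrite !mxE /nmoment.
rewrite (_ : n.+1%:Z - n%:Z + i%:Z = i.+1%:Z); first by field.
by lia.
Qed.

Lemma moment_P_horner {R : realType} (mu : circle_measure R) (n : nat) :
  on_circle mu -> even_measure mu -> nondegenerate mu ->
  moment_P mu n = (monic_op mu n).[1].
Proof.
move=> muC muE dn0; rewrite horner1_monic_op horner_poly big_ord_recl subn0
  coef_monic_op expr1n mul1r.
rewrite /moment_P -mulmxA reversed_op_normal_eq // mulmxN !mxE opprK;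
  congr (_ + _).
apply: eq_bigr => i _; rewrite !mxE mul1r expr1n mulr1 coef_poly ltnS.
by rewrite /= ltn_ord.
Qed.

(** * Real coefficients and real values at 1 *)

(** As the moments are real, conjugating the coefficients preserves the orthogonality relations, and
    uniqueness applies. Reality turns the squared modulus in h_(n+1) into a plain square. *)
Lemma monic_op_real {R : realType} (mu : circle_measure R) (n : nat) :
  on_circle mu -> even_measure mu -> nondegenerate mu ->
  map_poly Num.conj (monic_op mu n) = monic_op mu n.
Proof.
move=> muC muE dn0.
have conjp (p : {poly R[i]}) k : circle_dot mu (map_poly Num.conj p) 'X^k =
  (circle_dot mu p 'X^k)^*%R.
  have sp : (size (map_poly Num.conj p) <= size p)%N by rewrite size_map_poly.
  rewrite (circle_dot_coef _ _ sp) (circle_dot_coef _ _ (leqnn _))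
    rmorph_sum /=.
  by apply: eq_bigr => l _; rewrite coef_map rmorphM /= moment_real.
apply: (monic_op_unique dn0) => [|k kn]; last first.
  by rewrite conjp monic_op_orthX // rmorph0.
by rewrite -(map_polyXn Num.conj) -rmorphB /= size_map_poly size_monic_op_low.
Qed.

Lemma verblunsky_real {R : realType} (mu : circle_measure R) (n : nat) :
  on_circle mu -> even_measure mu -> nondegenerate mu ->
  (verblunsky mu n)^*%R = verblunsky mu n.
Proof.
move=> muC muE dn0; rewrite /verblunsky fmorph_div /=; congr (_ / _);
  last exact: circle_dot_conj.
rewrite -reversed_op_dotXS // circle_dot_reversed_op rmorph_sum;
  apply: eq_bigr => i _.
by rewrite rmorphM /= -coef_map monic_op_real // moment_real.
Qed.

Lemma moment_P_real {R : realType} (mu : circle_measure R) (n : nat) :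
  on_circle mu -> even_measure mu -> nondegenerate mu ->
  (moment_P mu n)^*%R = moment_P mu n.
Proof.
move=> muC muE dn0; rewrite moment_P_horner // -{2}monic_op_real //.
by rewrite -[in RHS](rmorph1 Num.conj) horner_map.
Qed.

(** * Solving for the next moment *)

Lemma sqnorm_orthonormal_poly1 {R : realType} (mu : circle_measure R) (n : nat) :
  `|(orthonormal_poly mu n).[1]| ^+ 2 =
  `|(monic_op mu n).[1]| ^+ 2 / circle_dot mu (monic_op mu n) (monic_op mu n).
Proof.
rewrite orthonormal_polyE hornerZ normrM exprMn normfV exprVn -normrX sqrtCK.
by rewrite (ger0_norm (circle_dot_ge0 _ _)) mulrC.
Qed.

Theorem mainTheorem3 (R : realType) (h : nat -> R)
    (h_gt0 : forall n : nat, 0 < h n)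
    (mu : {finite_measure set (measurableTypeR R) -> \bar R})
    (mu_circle : on_circle mu)
    (mu_even : even_measure mu)
    (mu_h : forall n : nat, `|(orthonormal_poly mu n).[1]| ^+ 2 = (h n)%:C)
    (n : nat) (n_gt1 : (1 < n)%N) :
  let ht : R[i] := (h n.+1 / h 0%N)%:C in
  let Delta : R[i] := moment_Delta mu n in
  let D : R[i] := moment_D mu n in
  let P : R[i] := moment_P mu n in
  moment mu (n.+1)%:Z =
    1 / (h 0%N)%:C *
    (((1 + D / Delta) * P ^+ 2 - (Delta - D) * ht) /
     (ht + P ^+ 2 / Delta)).
Proof.
have hC0 k : (h k)%:C != 0 by rewrite (inj_eq (@complexI R)) gt_eqF.
have hE k : (h k)%:C =
    `|(monic_op mu k).[1]| ^+ 2 / circle_dot mu (monic_op mu k) (monic_op mu k).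
  by rewrite -mu_h sqnorm_orthonormal_poly1.
(* Nondegeneracy follows from h_k != 0: a zero squared norm, whose inverse is 0 by convention, would
   give h_k = 0. *)
have dn0 k : circle_dot mu (monic_op mu k) (monic_op mu k) != 0.
  by apply: contra_neq (hC0 k) => d0; rewrite hE d0 invr0 mulr0.
move=> ht Delta D P; rewrite /ht rmorphM fmorphV /=.
have m0E : moment mu 0 = (h 0%N)%:C^-1.
  by rewrite hE moment0_sqnorm monic_op0 hornerC normr1 expr1n div1r invrK.
have m0 : moment mu 0 != 0 by rewrite -moment0_sqnorm.
have dE : circle_dot mu (monic_op mu n) (monic_op mu n) = moment mu 0 * Delta.
  exact: moment_Delta_sqnorm.
have Delta0 : Delta != 0.
  by apply: contra_neq (dn0 n) => d0; rewrite dE d0 mulr0.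
have PE : P = (monic_op mu n).[1] by exact: moment_P_horner.
have P0 : P != 0.
  by apply: contra_neq (hC0 n) => p0; rewrite hE -PE p0 normr0 expr0n mul0r.
set a := verblunsky mu n.
have aE : circle_dot mu ('X * monic_op mu n) 1 = a * (moment mu 0 * Delta).
  by rewrite -dE /a /verblunsky mulfVK.
have mE : moment mu n.+1%:Z = moment mu 0 * (D + a * Delta).
  by rewrite moment_D_dot // aE /D; ring.
(* This factor is E_(n+1) / E_n. *)
have a1 : 1 - a ^+ 2 != 0.
  by apply: contra_neq (dn0 n.+1) => a1; rewrite sqnorm_monic_opS // a1 mulr0.
have aP1 : 1 + a != 0.
  by apply: contra_neq a1 => aP1; rewrite -[1](expr1n _ 2) subr_sqr aP1 mulr0.
have hS : (h n.+1)%:C =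
  ((1 - a) * P) ^+ 2 / (moment mu 0 * Delta * (1 - a ^+ 2)).
  rewrite hE horner1_monic_opS // sqnorm_monic_opS // dE -/a -PE; congr (_ / _).
  by rewrite normCK rmorphM rmorphB rmorph1 /= verblunsky_real //
    moment_P_real // expr2.
rewrite mE hS -m0E mul1r.
(* One factor 1 - a cancels since 1 - a^2 = (1 - a)(1 + a). *)
have -> : ((1 - a) * P) ^+ 2 / (moment mu 0 * Delta * (1 - a ^+ 2)) * moment mu
  0 =
    P ^+ 2 / Delta * ((1 - a) / (1 + a)).
  by field; rewrite m0 Delta0 a1 aP1.
(* The denominator of the formula is (P^2 / Delta) * 2 / (1 + a), so its nonvanishing comes down to
   2 P^2 != 0. *)
field; rewrite Delta0 aP1 /= -mulrDr addrCA subrK.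
by rewrite mulf_neq0 ?expf_neq0 // pnatr_eq0.
Qed.
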